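(* For all real numbers $a,b>0$, writing $H=H(a,b)$, $G=G(a,b)$, $A=A(a,b)$, $S=S(a,b)$, $$H\le \frac{2AH}{A+H}\le G\le \frac{2H+S}{3}\le \frac{A+H}{2}\le \sqrt{\frac{A^2+H^2}{2}}\le \frac{S+G}{2}\le \frac{H+2S}{3}\le A\le S+H-G\le S\le 3(A-G)+H.$$
   Context: For $a,b>0$ define the means $H(a,b)=\frac{2ab}{a+b}$, $G(a,b)=\sqrt{ab}$, $A(a,b)=\frac{a+b}{2}$, $S(a,b)=\sqrt{\frac{a^2+b^2}{2}}$. *)

(* Defs.v *)
From Stdlib Require Import Reals.
Open Scope R_scope.

Definition harmonic_mean (a b : R) : R := 2 * a * b / (a + b).

Definition geometric_mean (a b : R) : R := sqrt (a * b).

Definition arithmetic_mean (a b : R) : R := (a + b) / 2.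

Definition root_square_mean (a b : R) : R := sqrt ((a ^ 2 + b ^ 2) / 2).

(* Main.v *)
Require Import Defs.
From Stdlib Require Import Reals Lra.
Open Scope R_scope.

(** The four means satisfy [G^2 = A * H] and [S^2 + G^2 = 2 * A^2], together
    with [G <= A].  Dividing by [A], the whole chain therefore depends on the
    single parameter [g = G / A], which satisfies [0 < g <= 1]: one has
    [H / A = g^2] and [S / A = s] with [s^2 = 2 - g^2] and [s >= 1]
    ([means_parametrization]).

    The links that do not involve [S], and [S + H - G <= S], reduce to
    [g^2 <= g <= 1] or to the positivity of a square.  The one bounding
    [sqrt ((A^2 + H^2) / 2)] from above reduces, after squaring, to
    [g^4 <= g * s].  Each remaining link compares [s] with a quadratic
    polynomial [q(g)].  There [s^2 - q(g)^2] is a polynomial in [g] with a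
    multiple root at [g = 1] (where all means coincide), and the cofactor has
    constant sign for [0 <= g <= 1].  Only four such comparisons occur:

    - [s >= 3 g - 2 g^2], for [G <= (2H + S)/3] and [(S + G)/2 <= (H + 2S)/3];
    - [s <= (3 - g^2) / 2], for [(2H + S)/3 <= (A + H)/2] and
      [(H + 2S)/3 <= A];
    - [s >= 1 + g - g^2], for [A <= S + H - G];
    - [s <= 3 - 3 g + g^2], for [S <= 3 (A - G) + H]. *)

Lemma arithmetic_mean_gt0 (a b : R) :
  0 < a -> 0 < b -> 0 < arithmetic_mean a b.
Proof. unfold arithmetic_mean; lra. Qed.

Lemma geometric_mean_gt0 (a b : R) :
  0 < a -> 0 < b -> 0 < geometric_mean a b.
Proof. intros ha hb; apply sqrt_lt_R0; nra. Qed.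

Lemma geometric_mean_sqr (a b : R) :
  0 < a -> 0 < b -> geometric_mean a b ^ 2 = a * b.
Proof. intros ha hb; apply pow2_sqrt; nra. Qed.

Lemma root_square_mean_sqr (a b : R) :
  root_square_mean a b ^ 2 = (a ^ 2 + b ^ 2) / 2.
Proof. apply pow2_sqrt; nra. Qed.

Lemma geometric_le_arithmetic (a b : R) :
  0 < a -> 0 < b -> geometric_mean a b <= arithmetic_mean a b.
Proof.
intros ha hb.
pose proof (arithmetic_mean_gt0 a b ha hb) as A_gt0.
apply Rsqr_incr_0_var; [|lra].
rewrite !Rsqr_pow2, geometric_mean_sqr by assumption.
unfold arithmetic_mean; pose proof (pow2_ge_0 (a - b)); nra.
Qed.

(** All four means are [A] times a function of [g = G / A] alone, so any
    homogeneous inequality between them is a one-variable statement. *)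
Lemma means_parametrization (a b : R) :
  0 < a -> 0 < b ->
  exists g s : R,
    (0 < g <= 1 /\ 0 <= s /\ s ^ 2 = 2 - g ^ 2) /\
    geometric_mean a b = arithmetic_mean a b * g /\
    harmonic_mean a b = arithmetic_mean a b * g ^ 2 /\
    root_square_mean a b = arithmetic_mean a b * s.
Proof.
intros ha hb.
pose proof (arithmetic_mean_gt0 a b ha hb) as A_gt0.
pose proof (geometric_mean_gt0 a b ha hb) as G_gt0.
pose proof (geometric_mean_sqr a b ha hb) as G2.
pose proof (root_square_mean_sqr a b) as S2.
pose proof (geometric_le_arithmetic a b ha hb) as GA.
exists (geometric_mean a b / arithmetic_mean a b).
exists (root_square_mean a b / arithmetic_mean a b).
repeat split.
- now apply Rdiv_lt_0_compat.
- apply Rmult_le_reg_r with (arithmetic_mean a b); [assumption|].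
  unfold Rdiv; rewrite Rmult_assoc, Rinv_l; lra.
- apply Rmult_le_pos; [apply sqrt_pos|].
  left; now apply Rinv_0_lt_compat.
- unfold Rdiv; rewrite !Rpow_mult_distr, S2, G2.
  unfold arithmetic_mean; field; lra.
- field; lra.
- unfold Rdiv; rewrite Rpow_mult_distr, G2.
  unfold harmonic_mean, arithmetic_mean; field; lra.
- field; lra.
Qed.

(** If [x] exceeded [y], both would be nonnegative and squaring would keep the
    strict inequality. *)
Lemma le_of_sqr_le (x y : R) : 0 <= y -> x ^ 2 <= y ^ 2 -> x <= y.
Proof. intros y_ge0 le_xy; nra. Qed.

Lemma s_ge1 (g s : R) :
  0 < g <= 1 -> 0 <= s -> s ^ 2 = 2 - g ^ 2 ->
  1 <= s.
Proof. intros g_bounds s_ge0 s_sqr. apply le_of_sqr_le; nra. Qed.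

Lemma s_ge_3g_2g2 (g s : R) :
  0 < g <= 1 -> 0 <= s -> s ^ 2 = 2 - g ^ 2 ->
  3 * g - 2 * g ^ 2 <= s.
Proof.
intros g_bounds s_ge0 s_sqr.
apply le_of_sqr_le; [assumption|].
assert (gap : s ^ 2 - (3 * g - 2 * g ^ 2) ^ 2
              = (1 - g) ^ 2 * (2 + 4 * g * (1 - g))) by (rewrite s_sqr; ring).
assert (0 <= (1 - g) ^ 2 * (2 + 4 * g * (1 - g))); [|lra].
apply Rmult_le_pos; [apply pow2_ge_0 | nra].
Qed.

Lemma s_le_half_3_g2 (g s : R) :
  s ^ 2 = 2 - g ^ 2 ->
  s <= (3 - g ^ 2) / 2.
Proof.
intros s_sqr.
apply le_of_sqr_le; [nra|].
assert (gap : ((3 - g ^ 2) / 2) ^ 2 - s ^ 2 = ((1 - g ^ 2) / 2) ^ 2)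
  by (rewrite s_sqr; field).
pose proof (pow2_ge_0 ((1 - g ^ 2) / 2)); lra.
Qed.

(** Here the two sides agree to second order at [g = 1], hence the cube. *)
Lemma s_ge_1_g_g2 (g s : R) :
  0 < g <= 1 -> 0 <= s -> s ^ 2 = 2 - g ^ 2 ->
  1 + g - g ^ 2 <= s.
Proof.
intros g_bounds s_ge0 s_sqr.
apply le_of_sqr_le; [assumption|].
assert (gap : s ^ 2 - (1 + g - g ^ 2) ^ 2 = (1 - g) ^ 3 * (1 + g))
  by (rewrite s_sqr; ring).
assert (0 <= (1 - g) ^ 3 * (1 + g)); [|lra].
apply Rmult_le_pos; [apply pow_le; lra | lra].
Qed.

Lemma s_le_3_3g_g2 (g s : R) :
  0 < g <= 1 -> s ^ 2 = 2 - g ^ 2 ->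
  s <= 3 - 3 * g + g ^ 2.
Proof.
intros g_bounds s_sqr.
apply le_of_sqr_le; [nra|].
assert (gap : (3 - 3 * g + g ^ 2) ^ 2 - s ^ 2
              = (1 - g) ^ 2 * ((2 - g) ^ 2 + 3)) by (rewrite s_sqr; ring).
assert (0 <= (1 - g) ^ 2 * ((2 - g) ^ 2 + 3)); [|lra].
apply Rmult_le_pos; [apply pow2_ge_0 | pose proof (pow2_ge_0 (2 - g)); lra].
Qed.

Lemma g4_le_gs (g s : R) :
  0 < g <= 1 -> 0 <= s -> s ^ 2 = 2 - g ^ 2 ->
  g ^ 4 <= g * s.
Proof.
intros g_bounds s_ge0 s_sqr.
pose proof (s_ge1 g s g_bounds s_ge0 s_sqr).
apply Rle_trans with (g * 1); [|nra].
replace (g ^ 4) with (g * g ^ 3) by ring.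
apply Rmult_le_compat_l; [lra|].
replace 1 with (1 ^ 3) by ring.
apply pow_incr; lra.
Qed.

(** Squaring and using [S^2 + G^2 = 2 * A^2] leaves [H^2 <= G * S]. *)
Lemma sqrt_mean_le (A g s : R) :
  0 < A -> 0 < g <= 1 -> 0 <= s -> s ^ 2 = 2 - g ^ 2 ->
  sqrt ((A ^ 2 + (A * g ^ 2) ^ 2) / 2) <= (A * s + A * g) / 2.
Proof.
intros A_gt0 g_bounds s_ge0 s_sqr.
apply le_of_sqr_le; [nra|].
rewrite pow2_sqrt by nra.
assert (gap : ((A * s + A * g) / 2) ^ 2 - (A ^ 2 + (A * g ^ 2) ^ 2) / 2
              = A ^ 2 / 2 * (g * s - g ^ 4)).
{ replace (((A * s + A * g) / 2) ^ 2)
    with (A ^ 2 * (s ^ 2 + g ^ 2 + 2 * g * s) / 4) by field.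
  rewrite s_sqr; field. }
assert (0 <= A ^ 2 / 2 * (g * s - g ^ 4)); [|lra].
pose proof (g4_le_gs g s g_bounds s_ge0 s_sqr).
apply Rmult_le_pos; nra.
Qed.

Theorem corollary3p2 (a b : R) (ha : 0 < a) (hb : 0 < b) :
  let H := harmonic_mean a b in
  let G := geometric_mean a b in
  let A := arithmetic_mean a b in
  let S := root_square_mean a b in
  H <= 2 * A * H / (A + H) /\
  2 * A * H / (A + H) <= G /\
  G <= (2 * H + S) / 3 /\
  (2 * H + S) / 3 <= (A + H) / 2 /\
  (A + H) / 2 <= sqrt ((A ^ 2 + H ^ 2) / 2) /\
  sqrt ((A ^ 2 + H ^ 2) / 2) <= (S + G) / 2 /\
  (S + G) / 2 <= (H + 2 * S) / 3 /\
  (H + 2 * S) / 3 <= A /\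
  A <= S + H - G /\
  S + H - G <= S /\
  S <= 3 * (A - G) + H.
Proof.
intros H G A S.
assert (A_gt0 : 0 < A) by exact (arithmetic_mean_gt0 a b ha hb).
destruct (means_parametrization a b ha hb)
  as (g & s & (g_bounds & s_ge0 & s_sqr) & G_eq & H_eq & S_eq).
fold G A in G_eq; fold H A in H_eq; fold S A in S_eq.
clearbody H G A S; subst G H S.
pose proof (s_ge_3g_2g2 g s g_bounds s_ge0 s_sqr) as lower1.
pose proof (s_ge_1_g_g2 g s g_bounds s_ge0 s_sqr) as lower2.
pose proof (s_le_half_3_g2 g s s_sqr) as upper1.
pose proof (s_le_3_3g_g2 g s g_bounds s_sqr) as upper2.
assert (g2_le_g : g ^ 2 <= g) by nra.
(* [2AH/(A+H)] is [A] times the harmonic mean of [1] and [g^2]. *)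
assert (AH_eq : 2 * A * (A * g ^ 2) / (A + A * g ^ 2)
                = A * (2 * g ^ 2 / (1 + g ^ 2)))
  by (field; split; nra).
assert (denom : 2 * g ^ 2 / (1 + g ^ 2) * (1 + g ^ 2) = 2 * g ^ 2)
  by (field; nra).
rewrite AH_eq.
repeat split.
- apply Rmult_le_compat_l; [lra|].
  apply Rmult_le_reg_r with (1 + g ^ 2); nra.
- apply Rmult_le_compat_l; [lra|].
  apply Rmult_le_reg_r with (1 + g ^ 2); [nra|].
  rewrite denom; pose proof (pow2_ge_0 (1 - g)); nra.
- nra.
- nra.
- apply le_of_sqr_le; [apply sqrt_pos|].
  rewrite pow2_sqrt by nra.
  pose proof (pow2_ge_0 (A - A * g ^ 2)); nra.
- exact (sqrt_mean_le A g s A_gt0 g_bounds s_ge0 s_sqr).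
- nra.
- nra.
- nra.
- nra.
- nra.
Qed.
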